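(* Given a zonotope $\mathcal{Z}=\langle c,G\rangle_Z\subset\mathbb{R}^n$ and a polytope $\mathcal{P}=\langle[v_1\ \dots\ v_s]\rangle_V\subset\mathbb{R}^n$ with vertices $v_1,\dots,v_s$, their Minkowski difference can be represented by the constrained zonotope $$\mathcal{Z}\ominus\mathcal{P}=\langle c-v_1,[G\ \mathbf{0}],A,b\rangle_{CZ},$$ where $$A=\begin{bmatrix} G & -G & \dots & \mathbf{0} \\ \vdots & \vdots & \ddots & \vdots \\ G & \mathbf{0} & \dots & -G \end{bmatrix},\qquad b=\begin{bmatrix} v_1-v_2 \\ \vdots \\ v_1-v_s \end{bmatrix}.$$
   Context: A zonotope with center $c\in\mathbb{R}^n$ and generator matrix $G\in\mathbb{R}^{n\times\gamma}$ is $\langle c,G\rangle_Z=\{c+\sum_{i=1}^\gamma G_{(\cdot,i)}\alpha_i:\alpha_i\in[-1,1]\}$. A constrained zonotope is $\langle c,G,A,b\rangle_{CZ}=\{c+\sum_iG_{(\cdot,i)}\alpha_i:\sum_iA_{(\cdot,i)}\alpha_i=b,\ \alpha_i\in[-1,1]\}$. The vertex representation of a polytope is $\langle[v_1\ \dots\ v_s]\rangle_V=\{\sum_{i=1}^s\beta_iv_i:\sum_i\beta_i=1,\ \beta_i\ge0\}$. The Minkowski difference is $\mathcal{S}_1\ominus\mathcal{S}_2=\{x:x\oplus\mathcal{S}_2\subseteq\mathcal{S}_1\}$, with $\oplus$ the Minkowski sum. $\mathbf{0}$ denotes a zero matrix of appropriate size: $[G\ \mathbf{0}]$ has $s\gamma$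 columns, and $A$ has $s-1$ block rows and $s$ block columns, the $j$-th block row ($j=1,\dots,s-1$) having $G$ in block column $1$, $-G$ in block column $j+1$ and zeros elsewhere. *)

(* Defs.v *)
From HB Require Import structures.
From mathcomp Require Import all_boot all_order all_algebra.
From mathcomp Require Import boolp classical_sets reals.

Set Implicit Arguments.
Unset Strict Implicit.
Unset Printing Implicit Defensive.

Import Order.TTheory GRing.Theory Num.Theory.

Local Open Scope classical_set_scope.
Local Open Scope ring_scope.

Definition minkowski_sum (V : zmodType) (S1 S2 : set V) : set V :=
  [set x + y | x in S1 & y in S2].

Definition minkowski_diff (V : zmodType) (S1 S2 : set V) : set V :=
  [set x | minkowski_sum [set x] S2 `<=` S1].

Definition zonotope (R : realType) (n g : nat)
    (c : 'cV[R]_n) (G : 'M[R]_(n, g)) : set 'cV[R]_n :=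
  [set x | exists2 alpha : 'I_g -> R, forall i, -1 <= alpha i <= 1 &
     x = c + \sum_i alpha i *: col i G].

Definition constrained_zonotope (R : realType) (n g q : nat)
    (c : 'cV[R]_n) (G : 'M[R]_(n, g)) (A : 'M[R]_(q, g)) (b : 'cV[R]_q) :
    set 'cV[R]_n :=
  [set x | exists alpha : 'I_g -> R,
     [/\ forall i, -1 <= alpha i <= 1,
         \sum_i alpha i *: col i A = b &
         x = c + \sum_i alpha i *: col i G]].

(* The points v_1, ..., v_s are the columns of M. *)
Definition vpolytope (R : realType) (n s : nat) (M : 'M[R]_(n, s)) :
    set 'cV[R]_n :=
  [set x | exists beta : 'I_s -> R,
     [/\ \sum_i beta i = 1,
         forall i, 0 <= beta i &
         x = \sum_i beta i *: col i M]].

(* Below, a polytope has s = m.+1 >= 1 points, indexed from 0: column ord0 is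
   v_1 and column (lift ord0 j), of value j.+1, is v_(j+2) for j : 'I_m.
   Block columns are indexed by 'I_m.+1 and block rows by 'I_m likewise; the
   numbers of columns and rows are thus the sums \sum_(k < m.+1) g = s * g and
   \sum_(j < m) n = (s - 1) * n. *)

Definition diff_generators (R : realType) (n g m : nat) (G : 'M[R]_(n, g)) :
    'M[R]_(n, \sum_(k < m.+1) g) :=
  \mxrow_(k < m.+1) (if k == ord0 then G else 0).

Definition diff_constr_mx (R : realType) (n g m : nat) (G : 'M[R]_(n, g)) :
    'M[R]_(\sum_(j < m) n, \sum_(k < m.+1) g) :=
  \mxblock_(j < m, k < m.+1)
    (if k == ord0 then G else if k == lift ord0 j then - G else 0).

Definition diff_constr_rhs (R : realType) (n m : nat) (M : 'M[R]_(n, m.+1)) :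
    'cV[R]_(\sum_(j < m) n) :=
  \mxcol_(j < m) (col ord0 M - col (lift ord0 j) M).

(* Main.v *)
Require Import Defs.
From HB Require Import structures.
From mathcomp Require Import all_boot all_order all_algebra.
From mathcomp Require Import boolp classical_sets reals.
Import Order.TTheory GRing.Theory Num.Theory.
Local Open Scope classical_set_scope.
Local Open Scope ring_scope.

(** Three facts carry the identity.

    - A zonotope is convex ([zonotope_convex]), so the translate of a polytope
      lies in it as soon as the translates of the listed points do
      ([minkowski_diff_vpolytopeP]).  Hence [x] is in the difference iff
      for each point [v_k] there is a coefficient vector [a_k] in the unit box
      with [x + v_k = c + G a_k].

    - Solving the equation of index [0] gives [x = (c - v_0) + G a_0].
      Substituting this value in the equation of index [j + 1] turns it into
      [G a_0 - G a_(j+1) = v_0 - v_(j+1)].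

    - Stacking the [a_k] in one vector [a] of the unit box, the former equation
      is [x = (c - v_0) + [G 0] a] and the latter ones form the system [A a = b],
      by blockwise multiplication ([mul_diff_generators],
      [mul_diff_constr_mx]).  Since stacking is a bijection between
      families of vectors and long vectors, which preserves membership in the
      unit box ([unit_box_submxcol], [unit_box_mxcol]), nothing is lost in
      either direction. *)

Definition unit_box (R : realType) (g : nat) : set 'cV[R]_g :=
  [set a | forall i, -1 <= a i 0 <= 1].

Lemma sum_scale_col (R : realType) (n g : nat) (a : 'I_g -> R)
    (G : 'M[R]_(n, g)) :
  \sum_i a i *: col i G = G *m (\col_i a i).
Proof.
apply/colP => k; rewrite summxE !mxE; apply: eq_bigr => i _.
by rewrite !mxE mulrC.
Qed.

Lemma zonotopeP (R : realType) (n g : nat) (c : 'cV[R]_n)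
    (G : 'M[R]_(n, g)) (x : 'cV[R]_n) :
  zonotope c G x <-> exists2 a, unit_box R g a & x = c + G *m a.
Proof.
split=> [[a a1 ->]|[a a1 ->]].
  by exists (\col_i a i); [move=> i; rewrite mxE | rewrite sum_scale_col].
exists (fun i => a i 0) => //; rewrite sum_scale_col.
by congr (_ + _ *m _); apply/colP => i; rewrite mxE.
Qed.

Lemma constrained_zonotopeP (R : realType) (n g q : nat) (c : 'cV[R]_n)
    (G : 'M[R]_(n, g)) (A : 'M[R]_(q, g)) (b : 'cV[R]_q) (x : 'cV[R]_n) :
  constrained_zonotope c G A b x <->
  exists a, [/\ unit_box R g a, A *m a = b & x = c + G *m a].
Proof.
split=> [[a [a1 <- ->]]|[a [a1 <- ->]]].
  by exists (\col_i a i); split; rewrite ?sum_scale_col // => i; rewrite mxE.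
have colE : \col_i a i 0 = a by apply/colP => i; rewrite mxE.
by exists (fun i => a i 0); split; rewrite ?sum_scale_col ?colE.
Qed.

Lemma unit_box_convex (R : realType) (g s : nat) (beta : 'I_s -> R)
    (a : 'I_s -> 'cV[R]_g) :
  \sum_k beta k = 1 -> (forall k, 0 <= beta k) ->
  (forall k, unit_box R g (a k)) -> unit_box R g (\sum_k beta k *: a k).
Proof.
move=> beta1 beta0 a1 i; rewrite summxE.
under eq_bigr do rewrite mxE.
apply/andP; split.
  rewrite -beta1 -sumrN; apply: ler_sum => k _.
  by rewrite -mulrN1 ler_wpM2l //; case/andP: (a1 k i).
rewrite -[leRHS]beta1; apply: ler_sum => k _.
by rewrite -[leRHS]mulr1 ler_wpM2l //; case/andP: (a1 k i).
Qed.

(** The center is the only part of a zonotope that is not linear in the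
    coefficient vector, and it is preserved because the weights sum to [1]. *)
Lemma zonotope_convex (R : realType) (n g s : nat) (c : 'cV[R]_n)
    (G : 'M[R]_(n, g)) (beta : 'I_s -> R) (y : 'I_s -> 'cV[R]_n) :
  \sum_k beta k = 1 -> (forall k, 0 <= beta k) ->
  (forall k, zonotope c G (y k)) -> zonotope c G (\sum_k beta k *: y k).
Proof.
move=> beta1 beta0 yZ.
have /choice[a aP] k : exists a, unit_box R g a /\ y k = c + G *m a.
  by have /zonotopeP[a] := yZ k; exists a.
apply/zonotopeP; exists (\sum_k beta k *: a k).
  by apply: unit_box_convex => // k; case: (aP k).
under eq_bigr do rewrite (aP _).2 scalerDr.
rewrite big_split /= -scaler_suml beta1 scale1r mulmx_sumr.
by congr (_ + _); apply: eq_bigr => k _; rewrite scalemxAr.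
Qed.

Lemma vpolytope_col (R : realType) (n s : nat) (M : 'M[R]_(n, s)) (k : 'I_s) :
  vpolytope M (col k M).
Proof.
exists (fun i => (i == k)%:R); split => [|i|]; last 2 first.
- exact: ler0n.
- rewrite (bigD1 k) //= eqxx scale1r big1 ?addr0 // => i /negPf->.
  by rewrite scale0r.
by rewrite (bigD1 k) //= eqxx big1 ?addr0 // => i /negPf->.
Qed.

(** Since convex weights sum to [1], translating a convex combination of points
    by [x] amounts to translating each point by [x]; the convexity of the
    zonotope then reduces the inclusion of the whole polytope to that of the
    listed points. *)
Lemma minkowski_diff_vpolytopeP (R : realType) (n g s : nat) (c : 'cV[R]_n)
    (G : 'M[R]_(n, g)) (M : 'M[R]_(n, s)) (x : 'cV[R]_n) :
  minkowski_diff (zonotope c G) (vpolytope M) x <->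
  forall k, zonotope c G (x + col k M).
Proof.
split=> [xP k|xM _ [_ -> [_ [beta [beta1 beta0 ->]]] <-]].
  by apply: xP; exists x => //; exists (col k M) => //; exact: vpolytope_col.
have -> : x + \sum_k beta k *: col k M = \sum_k beta k *: (x + col k M).
  under [RHS]eq_bigr do rewrite scalerDr.
  by rewrite big_split /= -scaler_suml beta1 scale1r.
exact: zonotope_convex.
Qed.

Lemma unit_box_mxcol (R : realType) (s g : nat) (a : 'I_s -> 'cV[R]_g) :
  (forall k, unit_box R g (a k)) -> unit_box R (\sum_(k < s) g) (\mxcol_k a k).
Proof. by move=> a1 i; rewrite mxE; apply: a1. Qed.

Lemma unit_box_submxcol (R : realType) (s g : nat)
    (a : 'cV[R]_(\sum_(k < s) g)) (k : 'I_s) :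
  unit_box R (\sum_(k < s) g) a -> unit_box R g (submxcol a k).
Proof. by move=> a1 i; rewrite mxE; apply: a1. Qed.

Lemma mul_diff_generators (R : realType) (n g m : nat) (G : 'M[R]_(n, g))
    (a : 'I_m.+1 -> 'cV[R]_g) :
  diff_generators m G *m (\mxcol_k a k) = G *m a ord0.
Proof.
rewrite /diff_generators mul_mxrow_mxcol big_ord_recl /= big1 ?addr0 // => k _.
by rewrite mul0mx.
Qed.

(** All blocks of the row [j] vanish except those of the columns [0] and [j + 1],
    so the system compares each [G a_(j+1)] with the single vector [G a_0]. *)
Lemma mul_diff_constr_mx (R : realType) (n g m : nat) (G : 'M[R]_(n, g))
    (a : 'I_m.+1 -> 'cV[R]_g) :
  diff_constr_mx m G *m (\mxcol_k a k) =
  \mxcol_(j < m) (G *m a ord0 - G *m a (lift ord0 j)).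
Proof.
rewrite /diff_constr_mx mul_mxblock_mxrow; apply: eq_mxcol => j.
rewrite big_ord_recl /= (bigD1 j) //= eqxx mulNmx big1 ?addr0 //.
by move=> k /negPf kj; rewrite (inj_eq lift_inj) kj mul0mx.
Qed.

Theorem proposition6 (R : realType) (n g m : nat)
    (c : 'cV[R]_n) (G : 'M[R]_(n, g)) (M : 'M[R]_(n, m.+1)) :
  minkowski_diff (zonotope c G) (vpolytope M) =
  constrained_zonotope (c - col ord0 M) (diff_generators m G)
    (diff_constr_mx m G) (diff_constr_rhs M).
Proof.
apply/seteqP; split=> x.
- move=> /minkowski_diff_vpolytopeP xM.
  have /choice[a aP] k : exists a, unit_box R g a /\ x + col k M = c + G *m a.
    by have /zonotopeP[a] := xM k; exists a.
  have GaE k : G *m a k = x + col k M - c by rewrite (aP k).2 addrC addKr.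
  apply/constrained_zonotopeP; exists (\mxcol_k a k); split.
  + by apply: unit_box_mxcol => k; case: (aP k).
  + rewrite mul_diff_constr_mx; apply: eq_mxcol => j.
    by rewrite !GaE opprB addrA subrK opprD addrACA subrr add0r.
  + by rewrite mul_diff_generators GaE addrC subrKA addrK.
- move=> /constrained_zonotopeP[a [a1]].
  rewrite -[a]submxcolK mul_diff_generators mul_diff_constr_mx /diff_constr_rhs.
  move=> /eq_mxcolP GaE ->; apply/minkowski_diff_vpolytopeP => k.
  apply/zonotopeP; exists (submxcol a k); first exact: unit_box_submxcol.
  case: (unliftP ord0 k) => [j|] ->; last by rewrite addrAC subrK.
  (* The block row [j] expresses [G a_(j+1)] as [G a_0 - (v_0 - v_(j+1))]. *)
  rewrite -[G *m submxcol a (lift ord0 j)](subKr (G *m submxcol a ord0)) GaE.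
  by rewrite (addrAC c) opprD opprK !addrA.
Qed.
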